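(* The constant $\frac29$ is best possible, in the following sense. (i) For every real $c>\frac29$ there exist convex bodies $A_0,A_1,A_2\subseteq\mathbb{R}^2$ with $|A_0|+|A_1|+|A_2|=1$ and $\frac12(A_0+A_2)\subseteq A_1$ such that, with $S=\bigcup_{i=0}^{2}(\{i\}\times A_i)\subseteq\mathbb{R}^3$, every $\mathbf{y}\in S$ satisfies $h_S(\mathbf{y})<c$. (ii) For every real $c>\frac29$ there exists a compact convex set $C\subseteq\mathbb{R}^3$ whose slices $C\cap(\{z\}\times\mathbb{R}^2)$ have positive area for exactly three integers $z$, such that for every point $\mathbf{y}\in C\cap(\mathbb{Z}\times\mathbb{R}^2)$ there is a closed halfspace $H\subseteq\mathbb{R}^3$ containing $\mathbf{y}$ with $\mu(C\cap H)<c\,\mu(C)$.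
   Context: A convex body is a nonempty compact convex set. $|\cdot|$ denotes area (two-dimensional Lebesgue measure) in $\mathbb{R}^2$, and $A_0+A_2$ is the Minkowski sum. For a Borel set $E\subseteq\mathbb{R}^{3}=\mathbb{R}\times\mathbb{R}^2$, the mixed-integer volume is $\mu(E)=\sum_{z\in\mathbb{Z}}|\{\mathbf{x}\in\mathbb{R}^2:(z,\mathbf{x})\in E\}|$. For $S=\bigcup_{i=0}^{2}(\{i\}\times A_i)$ and $\mathbf{y}\in\mathbb{R}^3$, the halfspace depth is $h_S(\mathbf{y})=\inf_{H\ni\mathbf{y}}\mu(S\cap H)$, where $H$ ranges over the closed halfspaces of $\mathbb{R}^3$ containing $\mathbf{y}$. *)

(* Defs.v *)
From mathcomp Require Import all_boot all_order all_algebra.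
From mathcomp Require Import all_classical all_reals all_analysis.

Set Implicit Arguments.
Unset Strict Implicit.
Unset Printing Implicit Defensive.

Import Order.TTheory GRing.Theory Num.Theory.
Import numFieldNormedType.Exports.

Local Open Scope classical_set_scope.
Local Open Scope ring_scope.

(* The plane is R * R and R^3 = R x R^2 is R * (R * R), the first coordinate
   being the one that takes integer values. *)

(* Lebesgue measure on the Borel sets of the plane, as a product measure; on
   other sets its value is not meaningful. *)
Definition area (R : realType) (A : set (R * R)) : \bar R :=
  (@lebesgue_measure R \x @lebesgue_measure R)%E A.

Definition convex_body (R : realType) (A : set (R * R)) : Prop :=
  [/\ A !=set0, compact A & convex_set A].

Definition minkowski_sum (R : realType) (A B : set (R * R)) : set (R * R) :=
  [set x + y | x in A & y in B].

Definition dilate (R : realType) (k : R) (A : set (R * R)) : set (R * R) :=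
  [set k *: x | x in A].

Definition slice (R : realType) (E : set (R * (R * R))) (z : R) : set (R * R) :=
  [set x | E (z, x)].

(* Meant for Borel sets E, as is area. *)
Definition mixed_volume (R : realType) (E : set (R * (R * R))) : \bar R :=
  \esum_(z in [set: int]) area (slice E z%:~R).

Definition closed_halfspace (R : realType) (H : set (R * (R * R))) : Prop :=
  exists (a : R * (R * R)) (b : R), a != 0 /\
    H = [set y | a.1 * y.1 + a.2.1 * y.2.1 + a.2.2 * y.2.2 <= b].

Definition layers (R : realType) (A0 A1 A2 : set (R * R)) :
    set (R * (R * R)) :=
  ([set 0] `*` A0) `|` ([set 1] `*` A1) `|` ([set 2] `*` A2).

Definition halfspace_depth (R : realType) (S : set (R * (R * R)))
    (y : R * (R * R)) : \bar R :=
  ereal_inf [set mixed_volume (S `&` H) |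
             H in [set H | closed_halfspace H /\ H y]].

(* Main.v *)
Require Import Defs.
From mathcomp Require Import all_boot all_order all_algebra.
From mathcomp Require Import all_classical all_reals all_analysis.
From mathcomp Require Import ring lra zify.

Import Order.TTheory GRing.Theory Num.Theory.
Import numFieldNormedType.Exports.

Local Open Scope classical_set_scope.
Local Open Scope ring_scope.

(* Take equal right triangles at heights 0 and 1 and a small homothetic copy
   (ratio e, or a point) at height 2. Some barycentric coordinate of any point
   of a triangle is at least 1/3, so a line through it cuts off at most 4/9 of
   the area, i.e. 2/9 when the triangle has area 1/2. A steeply tilted plane
   through this line avoids the other large triangle, and hence cuts off at most
   2/9 plus the area of the small one; the total volume is at least 1. *)

(** * Areas of right isosceles triangles *)

Definition triangle {R : realType} (a b s : R) : set (R * R) :=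
  [set p | [/\ a <= p.1, b <= p.2 & p.1 + p.2 <= s]].

Lemma integral_ramp {R : realType} (a m : R) : a <= m ->
  (\int[@lebesgue_measure R]_(x in `[a, m]) (m - x)%:E = ((m - a) ^+ 2 / 2)%:E)%E.
Proof.
(* The fundamental theorem of calculus is applied on a nondegenerate interval, so [a = m] is treated
   apart. *)
rewrite le_eqVlt => /predU1P[->|am].
  by rewrite set_itv1 integral_set1 subrr expr0n/= mul0r.
pose F (x : R) : R := - ((m - x) ^+ 2 / 2).
have dF (x : R) : is_derive x 1 F (m - x).
  rewrite /F; apply: is_derive_eq.
  by rewrite !scaler0 /GRing.scale/=; field.
have cF : continuous F.
  by move=> x; apply: differentiable_continuous; apply/derivable1_diffP.
rewrite (@continuous_FTC2 _ _ F) //.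
- by rewrite /F subrr -EFinB; congr EFin; field.
- apply: continuous_subspaceT => x; apply: cvgB; [exact: cvg_cst|exact: cvg_id].
- split => //.
  + by apply: cvg_at_right_filter; exact: cF.
  + by apply: cvg_at_left_filter; exact: cF.
- by move=> x _; rewrite derive1E derive_val.
Qed.

(** Fubini: for [a <= x <= s - b] the vertical section at [x] is a segment of length [s - b - x],
    and otherwise it is empty. Equality [a + b = s] is allowed, so that a single point counts as a
    triangle of area 0. *)
Lemma area_triangle {R : realType} (a b s : R) : a + b <= s ->
  area (triangle a b s) = ((s - a - b) ^+ 2 / 2)%:E.
Proof.
move=> abs; rewrite /area /product_measure1.
transitivity (\int[@lebesgue_measure R]_(x in `[a, (s - b)%R]) (s - b - x)%:E)%E.
  rewrite [RHS]integral_mkcond; apply: eq_integral => x _ /=.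
  rewrite patchE mem_setE in_itv/=.
  have -> : xsection (triangle a b s) x =
            if a <= x then `[b, s - x]%classic else set0.
    apply/seteqP; split => y; rewrite /xsection/= inE.
      by case=> /= -> by_ ?; rewrite /= in_itv/= by_ lerBrDl.
    by case: ifP => //= ax; rewrite in_itv/= lerBrDl => /andP[].
  case: ifPn => [ax|]; last by rewrite measure0.
  rewrite lebesgue_measure_itv/= lte_fin.
  case: ltP => bs.
    rewrite ifT; last by lra.
    by rewrite -EFinB; congr EFin; lra.
  (* Here [s - x <= b], so [x] can lie in the domain of integration only at its endpoint [s - b],
     where the ramp vanishes. *)
  by case: ifPn => // xs; congr EFin; lra.
by rewrite integral_ramp; [congr EFin; field | lra].
Qed.

(** * Mixed volume as a sum of at most three slices *)

Lemma area_set0 {R : realType} : area (@set0 (R * R)) = 0%E.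
Proof.
rewrite /area /product_measure1 integral0_eq// => x _ /=.
by rewrite xsection0 measure0.
Qed.

Lemma area_ge0 {R : realType} (A : set (R * R)) : (0 <= area A)%E.
Proof. exact: integral_ge0. Qed.

Lemma mixed_volume_three_slices {R : realType} (E : set (R * (R * R))) :
  (forall z : int, z != 0 -> z != 1 -> z != 2 -> slice E z%:~R = set0) ->
  mixed_volume E = (area (slice E 0) + area (slice E 1) + area (slice E 2))%E.
Proof.
move=> E0; rewrite /mixed_volume.
have g0 (z : int) : (0 <= area (slice E z%:~R))%E by exact: area_ge0.
(* The indices 0, 1 and 2 are split off one at a time; the remaining sum has only zero terms. *)
rewrite (esumID [set 0])// setTI esum_set1//.
rewrite (esumID [set 1])//.
rewrite (_ : _ `&` [set 1] = [set 1]); last first.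
  by apply/seteqP; split=> z/= => [[]//|->].
rewrite esum_set1// (esumID [set 2])//.
rewrite (_ : _ `&` [set 2] = [set 2]); last first.
  by apply/seteqP; split=> z/= => [[]//|->].
rewrite esum_set1// esum1 ?adde0 ?addeA//.
move=> z/= [[[_ /eqP z0] /eqP z1] /eqP z2].
by rewrite E0// area_set0.
Qed.

(** * Halfspaces that cut off little volume *)

(** The barycentric coordinates of [p] are [p.1], [p.2] and [1 - p.1 - p.2]. Where one of them is at
    least 1/3, the line parallel to the corresponding side cuts off a homothetic triangle of ratio
    at most 2/3, of area at most [(2/3)^2 / 2 = 2/9]. The bound on the linear form is what later
    permits tilting the line into a plane. *)
Lemma triangle_cut {R : realType} (p : R * R) : triangle 0 0 1 p ->
  exists u v : R,
    (forall q, triangle 0 0 1 q -> `|u * q.1 + v * q.2| <= 1) /\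
    (area (triangle 0 0 1 `&`
       [set q | (u * q.1 + v * q.2 <= u * p.1 + v * p.2)%R]) <= (2 / 9)%:E)%E.
Proof.
case: p => p1 p2 [/= p1_ge0 p2_ge0 p_le1].
have [p1_big|p1_small] := leP (1 / 3) p1.
  exists (-1), 0; split.
    by move=> [q1 q2] [/= ? ? ?]; rewrite ler_norml; apply/andP; split; lra.
  rewrite (_ : _ `&` _ = triangle p1 0 1).
    by rewrite area_triangle ?lee_fin; [nra|lra].
  apply/seteqP; split => [[q1 q2] /= [[/= ? ? ?] ?]|[q1 q2] [/= ? ? ?]].
    by split => /=; lra.
  by split; [split => /=; lra|rewrite /=; lra].
have [p2_big|p2_small] := leP (1 / 3) p2.
  exists 0, (-1); split.
    by move=> [q1 q2] [/= ? ? ?]; rewrite ler_norml; apply/andP; split; lra.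
  rewrite (_ : _ `&` _ = triangle 0 p2 1).
    by rewrite area_triangle ?lee_fin; [nra|lra].
  apply/seteqP; split => [[q1 q2] /= [[/= ? ? ?] ?]|[q1 q2] [/= ? ? ?]].
    by split => /=; lra.
  by split; [split => /=; lra|rewrite /=; lra].
(* Both coordinates are below 1/3, so [p1 + p2 < 2/3]. *)
exists 1, 1; split.
  by move=> [q1 q2] [/= ? ? ?]; rewrite ler_norml; apply/andP; split; lra.
rewrite (_ : _ `&` _ = triangle 0 0 (p1 + p2)).
  by rewrite area_triangle ?lee_fin; [nra|lra].
apply/seteqP; split => [[q1 q2] /= [[/= ? ? ?] ?]|[q1 q2] [/= ? ? ?]].
  by split => /=; lra.
by split; [split => /=; lra|rewrite /=; lra].
Qed.

(* The slope 3 outweighs the variation, at most 2, of [u q.1 + v q.2] over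
   [triangle 0 0 1]. *)
Lemma light_halfspace {R : realType} (e : R) (S : set (R * (R * R)))
    (z : int) (p : R * R) :
  0 <= e -> e <= 1 ->
  slice S 0 = triangle 0 0 1 -> slice S 1 = triangle 0 0 1 ->
  slice S 2 = triangle 0 0 e ->
  (forall k : int, k != 0 -> k != 1 -> k != 2 -> slice S k%:~R = set0) ->
  S (z%:~R, p) ->
  exists H, [/\ closed_halfspace H, H (z%:~R, p) &
    (mixed_volume (S `&` H) <= (2 / 9 + e ^+ 2 / 2)%:E)%E].
Proof.
move=> e_ge0 e_le1 S0 S1 S2 Sk Szp.
have slice_vol H : mixed_volume (S `&` H) =
    (area (triangle 0 0 1 `&` slice H 0) + area (triangle 0 0 1 `&` slice H 1)
     + area (triangle 0 0 e `&` slice H 2))%E.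
  rewrite -[X in area (X `&` slice H 0)]S0 -[X in area (X `&` slice H 1)]S1 -S2.
  apply: mixed_volume_three_slices => k k0 k1 k2.
  by rewrite -[RHS](set0I (slice H k%:~R)) -(Sk k k0 k1 k2).
have aTe : area (triangle 0 0 e) = (e ^+ 2 / 2)%:E.
  by rewrite area_triangle ?addr0// !subr0.
have sub_e q : triangle 0 0 e q -> triangle 0 0 1 q.
  by case=> ? ? ?; split => //; lra.
have [z0|z0] := eqVneq z 0.
  subst z; have Tp : triangle 0 0 1 p by rewrite -S0.
  have [u [v [uv1 cut]]] := triangle_cut p Tp.
  have /ler_normlP[up1 up2] := uv1 p Tp.
  (* At height 0 this is the planar cut. At heights 1 and 2 the left side is at least [3 - 1 = 2] on
     the triangles, while the right side is at most 1, so nothing is kept there. *)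
  exists [set y | 3 * y.1 + u * y.2.1 + v * y.2.2 <= u * p.1 + v * p.2].
  split.
  - exists (3, (u, v)), (u * p.1 + v * p.2); split => //.
    by apply/eqP => -[]; lra.
  - by rewrite /=; lra.
  - rewrite slice_vol (_ : triangle 0 0 1 `&` slice _ 1 = set0); last first.
      apply/seteqP; split => // q [/uv1 /ler_normlP[? ?]].
      by rewrite /slice/=; lra.
    rewrite (_ : triangle 0 0 e `&` _ = set0); last first.
      apply/seteqP; split => // q [/sub_e/uv1/ler_normlP[? ?]].
      by rewrite /slice/=; lra.
    rewrite area_set0 !adde0 (le_trans _ (_ : (2 / 9)%:E <= _)%E)//; last first.
      by rewrite lee_fin; nra.
    move: cut; congr (area (_ `&` _) <= _)%E.
    by apply/seteqP; split => q; rewrite /slice/=; lra.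
have [z1|z1] := eqVneq z 1.
  subst z; have Tp : triangle 0 0 1 p by rewrite -S1.
  have [u [v [uv1 cut]]] := triangle_cut p Tp.
  have /ler_normlP[up1 up2] := uv1 p Tp.
  (* The opposite tilt: at height 0 the left side is at least -1 and the right side at most -2, so
     the large triangle is avoided. At height 2 the left side is at most -5 and the right side at
     least -4, so the whole small triangle is kept, which costs [e ^+ 2 / 2]. *)
  exists [set y | - 3 * y.1 + u * y.2.1 + v * y.2.2 <= u * p.1 + v * p.2 - 3].
  split.
  - exists (- 3, (u, v)), (u * p.1 + v * p.2 - 3); split => //.
    by apply/eqP => -[]; lra.
  - by rewrite /=; lra.
  - rewrite slice_vol (_ : triangle 0 0 1 `&` slice _ 0 = set0); last first.
      apply/seteqP; split => // q [/uv1 /ler_normlP[? ?]].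
      by rewrite /slice/=; lra.
    rewrite (_ : triangle 0 0 e `&` _ = triangle 0 0 e); last first.
      apply/setIidl => q /sub_e/uv1/ler_normlP[? ?].
      by rewrite /slice/=; lra.
    rewrite area_set0 add0e aTe EFinD leeD2r//.
    move: cut; congr (area (_ `&` _) <= _)%E.
    by apply/seteqP; split => q; rewrite /slice/=; lra.
have [z2|z2] := eqVneq z 2; last first.
  by move: Szp; rewrite -[S _]/(slice S z%:~R p) Sk.
subst z.
(* The horizontal halfspace [y.1 >= 2] meets only the small triangle. *)
exists [set y | - 1 * y.1 + 0 * y.2.1 + 0 * y.2.2 <= -2]; split.
- exists (-1, (0, 0)), (-2); split => //.
  by apply/eqP => -[]; lra.
- by rewrite /=; lra.
- rewrite slice_vol (_ : triangle 0 0 1 `&` slice _ 0 = set0); last first.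
    by apply/seteqP; split => // q []; rewrite /slice/=; lra.
  rewrite (_ : triangle 0 0 1 `&` slice _ 1 = set0); last first.
    by apply/seteqP; split => // q []; rewrite /slice/=; lra.
  rewrite (_ : triangle 0 0 e `&` _ = triangle 0 0 e); last first.
    by apply/setIidl => q _; rewrite /slice/=; lra.
  by rewrite area_set0 !add0e aTe lee_fin; nra.
Qed.

(** * Compactness and convexity of triangles *)

Lemma closed_lerfun {R : realType} {T : topologicalType} (f g : T -> R) :
  continuous f -> continuous g -> closed [set x | f x <= g x].
Proof.
move=> cf cg.
rewrite (_ : [set x | _] = (g \- f) @^-1` [set t | 0 <= t]).
  apply: preimage_closed; last exact: closed_ge.
  by move=> x _; apply: cvgB; [exact: cg|exact: cf].
by apply/seteqP; split => x /=; rewrite subr_ge0.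
Qed.

Lemma compact_triangle {R : realType} (a b s : R) : compact (triangle a b s).
Proof.
(* Each coordinate is bounded above by [s] minus the lower bound of the other. *)
pose B : set (R * R) := `[a, s - b]%classic `*` `[b, s - a]%classic.
apply: (@subclosed_compact _ _ B).
- rewrite (_ : triangle a b s = [set p | a <= p.1] `&` [set p | b <= p.2]
                                `&` [set p | p.1 + p.2 <= s]).
    apply: closedI; first apply: closedI.
    + by apply: closed_lerfun => p; [exact: cvg_cst|exact: cvg_fst].
    + by apply: closed_lerfun => p; [exact: cvg_cst|exact: cvg_snd].
    + apply: closed_lerfun => p; last exact: cvg_cst.
      by apply: cvgD; [exact: cvg_fst|exact: cvg_snd].
  by apply/seteqP; split => p /= [] // [].
- by apply: compact_setX; exact: segment_compact.
- by move=> [x y] [/= ? ? ?]; split; rewrite /= in_itv/=; apply/andP; split; lra.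
Qed.

Lemma convex_triangle {R : realType} (a b s : R) :
  convex_set (triangle a b s : set (convex_lmodType (R * R)%type)).
Proof.
move=> [x1 x2] [y1 y2] l; rewrite !inE => -[/= ? ? ?] [/= ? ? ?].
have l0 : 0 <= l%:num by []. have l1 : l%:num <= 1 by [].
by split; rewrite /conv/= /GRing.scale/= /unstable.onem; nra.
Qed.

Lemma convex_body_triangle {R : realType} (a b s : R) : a + b <= s ->
  convex_body (triangle a b s).
Proof.
move=> abs; split; [exists (a, b)|exact: compact_triangle|exact: convex_triangle].
by split => /=.
Qed.

(** * The two examples, layers and truncated prism, and their integer slices *)

Lemma slice_layers {R : realType} (A0 A1 A2 : set (R * R)) :
  [/\ slice (layers A0 A1 A2) 0 = A0, slice (layers A0 A1 A2) 1 = A1,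
      slice (layers A0 A1 A2) 2 = A2 &
      forall k : int, k != 0 -> k != 1 -> k != 2 ->
        slice (layers A0 A1 A2) k%:~R = set0].
Proof.
split.
- apply/seteqP; split => [x [[]|] []/=|x ?]; try lra; first by [].
  by left; left.
- apply/seteqP; split => [x [[]|] []/=|x ?]; try lra; first by [].
  by left; right.
- apply/seteqP; split => [x [[]|] []/=|x ?]; try lra; first by [].
  by right.
- move=> k k0 k1 k2; apply/seteqP; split => // x [[]|] [/= kE _].
  + by move: k0; rewrite -(intr_eq0 R) kE eqxx.
  + by move: k1; rewrite -(eqr_int R) kE eqxx.
  + by move: k2; rewrite -(eqr_int R) kE eqxx.
Qed.

(* The last bound goes from 1 at height 1 to e at height 2; below height 1 it is
   implied by membership in [triangle 0 0 1]. *)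
Definition truncated_prism {R : realType} (e : R) : set (R * (R * R)) :=
  [set y | [/\ 0 <= y.1, y.1 <= 2, triangle 0 0 1 y.2 &
               y.2.1 + y.2.2 <= 1 - (1 - e) * (y.1 - 1)]].

Lemma compact_truncated_prism {R : realType} (e : R) :
  compact (truncated_prism e).
Proof.
pose B : set (R * (R * R)) := `[0, 2]%classic `*` triangle 0 0 1.
have cB : compact B.
  by apply: compact_setX; [exact: segment_compact|exact: compact_triangle].
apply: (@subclosed_compact _ _ B) => //.
- rewrite (_ : truncated_prism e = B `&`
      [set y | y.2.1 + y.2.2 <= 1 - (1 - e) * (y.1 - 1)]).
    apply: closedI.
      by apply: compact_closed => //; exact: norm_hausdorff.
    apply: closed_lerfun => y.
      apply: cvgD; apply: continuous_comp; try exact: cvg_snd.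
      exact: cvg_fst.
    apply: cvgB; first exact: cvg_cst.
    apply: cvgMr; apply: cvgB; last exact: cvg_cst.
    exact: cvg_fst.
  apply/seteqP; split => y /=.
    by case=> ? ? ? ?; do 2 split => //; rewrite /= in_itv/=; apply/andP.
  by case=> -[/=]; rewrite in_itv/= => /andP[? ?] ? ?; split.
- by move=> y [? ? ? _]; split => //; rewrite /= in_itv/=; apply/andP.
Qed.

Lemma convex_truncated_prism {R : realType} (e : R) :
  convex_set (truncated_prism e : set (convex_lmodType (R * (R * R))%type)).
Proof.
move=> x y l; rewrite !inE => -[x_ge0 x_le2 Tx x_le] [y_ge0 y_le2 Ty y_le].
have l0 : 0 <= l%:num by []. have l1 : l%:num <= 1 by [].
split; last 2 first.
- by apply/set_mem/(convex_triangle 0 0 1 x.2 y.2 l); exact: mem_set.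
- by rewrite /conv/= /GRing.scale/= /unstable.onem {Tx Ty}; nra.
- by rewrite /conv/= /GRing.scale/= /unstable.onem {Tx Ty x_le y_le}; nra.
- by rewrite /conv/= /GRing.scale/= /unstable.onem {Tx Ty x_le y_le}; nra.
Qed.

(** At heights 0, 1 and 2 the slanted bound on the coordinate sum is [2 - e], 1 and [e]; as
    [e <= 1], only the last can shrink the unit triangle. *)
Lemma slice_truncated_prism {R : realType} (e : R) : 0 <= e -> e <= 1 ->
  [/\ slice (truncated_prism e) 0 = triangle 0 0 1,
      slice (truncated_prism e) 1 = triangle 0 0 1,
      slice (truncated_prism e) 2 = triangle 0 0 e &
      forall k : int, k != 0 -> k != 1 -> k != 2 ->
        slice (truncated_prism e) k%:~R = set0].
Proof.
move=> e0 e1; rewrite /slice; split.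
- apply/seteqP; split => x; first by case.
  by move=> Tx; split => //=; case: Tx; lra.
- apply/seteqP; split => x; first by case.
  by move=> Tx; split => //=; case: Tx; lra.
- apply/seteqP; split => x /=.
    by case=> /= _ _ [? ? ?] ?; split; lra.
  by case=> ? ? ?; split; [| |split|]; rewrite /=; lra.
- move=> k k0 k1 k2; apply/seteqP; split => // x [/=].
  rewrite (ler0z R) -[2]/(2%:~R) ler_int => ? ?; lia.
Qed.

(** * Sharpness of 2/9 for layers and for convex sets *)

Theorem mainTheorem2 (R : realType) :
  (forall c : R, 2 / 9 < c ->
    exists A0 A1 A2 : set (R * R),
      [/\ convex_body A0, convex_body A1 & convex_body A2] /\
      (area A0 + area A1 + area A2 = 1)%E /\
      dilate 2^-1 (minkowski_sum A0 A2) `<=` A1 /\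
      (forall y : R * (R * R), layers A0 A1 A2 y ->
        (halfspace_depth (layers A0 A1 A2) y < c%:E)%E)) /\
  (forall c : R, 2 / 9 < c ->
    exists C : set (R * (R * R)),
      compact C /\
      convex_set C /\
      ([set z : int | (0 < area (slice C z%:~R))%E] #= `I_3)%card /\
      (forall y : R * (R * R),
        (C `&` (range (fun z : int => z%:~R) `*` [set: R * R])) y ->
        exists H : set (R * (R * R)),
          closed_halfspace H /\ H y /\
          (mixed_volume (C `&` H) < c%:E * mixed_volume C)%E)).
Proof.
have area1 : area (triangle 0 0 (1 : R)) = (2^-1)%:E.
  by rewrite area_triangle ?addr0// !subr0 expr1n div1r.
split => c c_gt.
  (* The case [e = 0]: the top body is the origin alone, so the areas sum to [1/2 + 1/2 + 0], and
     halving the unit triangle towards the origin keeps it inside itself. *)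
  exists (triangle 0 0 1), (triangle 0 0 1), (triangle 0 0 0).
  have [S0 S1 S2 Sk] :=
    slice_layers (triangle 0 0 1) (triangle 0 0 1) (triangle 0 0 (0 : R)).
  split; [by split; apply: convex_body_triangle; rewrite addr0|split; [|split]].
  - rewrite area1 area_triangle ?addr0// !subr0 expr0n/= mul0r adde0.
    by rewrite -EFinD; congr EFin; field.
  - move=> _ [_ [[x1 x2] [/= ? ? ?] [[y1 y2] [/= ? ? ?] <-]] <-].
    by split; rewrite /= /GRing.scale/=; lra.
  - move=> y Sy.
    have [z [p yE]] : exists (z : int) p, y = (z%:~R, p).
      case: y Sy => y0 p [[]|] [/= -> _].
      + by exists 0, p.
      + by exists 1, p.
      + by exists 2, p.
    subst y.
    have [//|//|H [cH Hy volH]] := light_halfspace _ _ z p _ _ S0 S1 S2 Sk Sy.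
    apply: (le_lt_trans (ereal_inf_lbound _)); first by exists H.
    by apply: (le_lt_trans volH); rewrite lte_fin expr0n/= mul0r addr0.
(* Positivity of [e] gives the slice at height 2 positive area; [e <= c - 2 / 9] provides the slack
   for the final estimate. *)
pose e := Num.min 1 (c - 2 / 9).
have e_gt0 : 0 < e by rewrite lt_min ltr01 subr_gt0.
have e_le1 : e <= 1 by rewrite ge_min lexx.
have e_lec : e <= c - 2 / 9 by rewrite ge_min lexx orbT.
have [S0 S1 S2 Sk] := slice_truncated_prism e (ltW e_gt0) e_le1.
exists (truncated_prism e); split; first exact: compact_truncated_prism.
split; first exact: convex_truncated_prism.
split.
  rewrite (_ : [set z : int | _] = Posz @` `I_3); last first.
    apply/seteqP; split => z /=.
      have [->|z0] := eqVneq z 0; first by exists 0%N.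
      have [->|z1] := eqVneq z 1; first by exists 1%N.
      have [->|z2] := eqVneq z 2; first by exists 2%N.
      by rewrite Sk// area_set0 ltxx.
    case=> -[|[|[|//]]] _ <-.
    - by rewrite S0 area1 lte_fin.
    - by rewrite S1 area1 lte_fin.
    - by rewrite S2 area_triangle ?addr0 ?(ltW e_gt0)// !subr0 lte_fin; nra.
  by apply: inj_card_eq => i j _ _ [].
move=> [y0 p] [Cy [[z _ /= zE] _]]; subst y0.
have [|//|H [cH Hy volH]] := light_halfspace e _ z p _ _ S0 S1 S2 Sk Cy.
  exact: ltW.
exists H; split => //; split => //; apply: (le_lt_trans volH).
(* The total volume is [1 + e^2/2 >= 1], so the right side is at least [c >= 2/9 + e], which exceeds
   [2/9 + e^2/2] because [0 < e <= 1]. *)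
rewrite mixed_volume_three_slices// S0 S1 S2 area1.
rewrite area_triangle ?addr0 ?(ltW e_gt0)// !subr0 -!EFinD -EFinM lte_fin.
nra.
Qed.
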